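(* Every quaternionic torus $T$ has at least one modulus in $\mathcal M$. In other words: for every quaternionic torus $T$ there exists $(v_2,v_3,v_4)\in\mathcal M$ such that $T$ is equivalent to $\mathbb H/L$, where $L=\mathbb Z+\mathbb Zv_2+\mathbb Zv_3+\mathbb Zv_4$ is the lattice generated by the special basis $\{1,v_2,v_3,v_4\}$.
   Context: $\mathbb H\cong\mathbb R^4$ is the skew field of quaternions with its Euclidean scalar product $\langle\cdot,\cdot\rangle$, and $\mathbb S=\{q\in\mathbb H: q^2=-1\}$. A function $f:\Omega\to\mathbb H$ on a domain $\Omega\subseteq\mathbb H$ is (slice) regular if for every $I\in\mathbb S$ its restriction $f_I$ to $\Omega\cap(\mathbb R+I\mathbb R)$ has continuous derivatives and $\frac12\left(\frac{\partial}{\partial x}+I\frac{\partial}{\partial y}\right)f_I(x+Iy)=0$. A rank-4 lattice in $\mathbb H$ is the additive subgroup generated by four $\mathbb R$-linearly independent elements (a basis of the lattice). A quaternionic torus is a quotient $T=\mathbb H/L$, $L$ a rank-4 lattice, with the atlas of local inverses of the projection $\pi:\mathbb H\to\mathbb H/L$ on small connected open sets. A map between two quaternionic tori is regular if its expressions in these charts are slice regular; a biregular diffeomorphism is a bijective regular map with regular inverse. Two tori are equivalent if there is a biregular diffeomorphism of one onto the other. The Gram matrix of an (ordered) basis $\{v_1,v_2,v_3,v_4\}$ is $(\langle v_i,v_j\rangle)_{i,j}$. A Gram matrix $R=(r_{i,j})$ is reduced (in the sense of Minkowski–Siegel) if and only if: B1) $r_{k,k+1}\ge 0$ for $k=1,2,3$;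 B2) for each $k=1,2,3,4$, $n R\,{}^tn\ge r_{k,k}$ for every $n=(n_1,n_2,n_3,n_4)\in\mathbb Z^4$ such that $\gcd(n_k,\dots,n_4)=1$. A basis of a lattice is reduced if its Gram matrix is reduced, and a special basis is a reduced basis whose first element is $1$. Set $\mathcal M=\{(v_2,v_3,v_4)\in\mathbb H^3:\{1,v_2,v_3,v_4\}\text{ is a special basis}\}$ (the fundamental set of quaternionic tori). An element $(v_2,v_3,v_4)\in\mathcal M$ is called (a representative of) the modulus of any torus equivalent to $\mathbb H/(\mathbb Z+\mathbb Zv_2+\mathbb Zv_3+\mathbb Zv_4)$. *)

(* Defs.v *)
From HB Require Import structures.
From mathcomp Require Import all_boot all_order all_algebra.
From mathcomp Require Import all_classical all_reals all_analysis.

Set Implicit Arguments.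
Unset Strict Implicit.
Unset Printing Implicit Defensive.

Import Order.TTheory GRing.Theory Num.Theory.
Import numFieldNormedType.Exports.

Local Open Scope classical_set_scope.
Local Open Scope ring_scope.
Local Open Scope quotient_scope.

(* The coordinates of a quaternion are those in the basis 1, i, j, k. The
   library's topology on row vectors comes from the sup norm; it is the
   Euclidean topology of R^4. *)
Notation quat R := 'rV[R]_4 (only parsing).

Section Quaternions.
Context {R : realType}.
Implicit Types p q : quat R.

Definition mkquat (a b c d : R) : quat R := \row_(i < 4) [:: a; b; c; d]`_i.

Definition qone : quat R := mkquat 1 0 0 0.

Definition qmul p q : quat R :=
  let: (a, b, c, d) := (p 0 0, p 0 1, p 0 2, p 0 3) in
  let: (a', b', c', d') := (q 0 0, q 0 1, q 0 2, q 0 3) in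
  mkquat (a * a' - b * b' - c * c' - d * d')
         (a * b' + b * a' + c * d' - d * c')
         (a * c' - b * d' + c * a' + d * b')
         (a * d' + b * c' - c * b' + d * a').

Definition qdot p q : R := \sum_(i < 4) p 0 i * q 0 i.

Definition imag_unit : set (quat R) := [set I | qmul I I = - qone].

Definition slice (I : quat R) (x y : R) : quat R := x *: qone + y *: I.

(* [f] is a total function, but for open [Omega] the conditions only depend on
   its values on [Omega]. *)
Definition slice_regular (Omega : set (quat R)) (f : quat R -> quat R) : Prop :=
  forall I, imag_unit I ->
  let fI x y := f (slice I x y) in
  let OmegaI := [set z : R * R | Omega (slice I z.1 z.2)] in
  let dx (z : R * R) := derive1 (fI^~ z.2) z.1 in
  let dy (z : R * R) := derive1 (fI z.1) z.2 in
  forall z, OmegaI z ->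
  [/\ derivable (fI^~ z.2) z.1 1 /\ derivable (fI z.1) z.2 1,
      {for z, continuous dx},
      {for z, continuous dy} &
      2^-1 *: (dx z + qmul I (dy z)) = 0].

End Quaternions.

Section Lattices.
Context {R : realType}.

Definition basis_of_lattice (L : {pred quat R}) (v : 4.-tuple (quat R)) : Prop :=
  free v /\ forall x, x \in L <-> inIntSpan v x.

Definition rank4_lattice (L : {pred quat R}) : Prop :=
  exists v, basis_of_lattice L v.

Definition zspan m (v : m.-tuple (quat R)) : {pred quat R} :=
  fun x => `[< inIntSpan v x >].

Lemma zspan_zmod_closed m (v : m.-tuple (quat R)) : zmod_closed (zspan v).
Proof.
split=> [|x y /asboolP[a ->] /asboolP[b ->]].
  by apply/asboolP; exists [ffun=> 0]; rewrite big1// => i _; rewrite ffunE mulr0z.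
apply/asboolP; exists [ffun i => a i - b i].
by rewrite -sumrB; apply: eq_bigr => i _; rewrite ffunE mulrzBr.
Qed.

HB.instance Definition _ m (v : m.-tuple (quat R)) :=
  GRing.isZmodClosed.Build (quat R) (zspan v) (zspan_zmod_closed v).

End Lattices.

Section Tori.
Context {R : realType}.

Definition torus (L : zmodClosed (quat R)) : Type :=
  quotient_topology (Quotient.quot L).

HB.instance Definition _ L := Topological.copy (torus L)
  (quotient_topology (Quotient.quot L)).
HB.instance Definition _ L := Quotient.copy (torus L)
  (quotient_topology (Quotient.quot L)).

Definition torus_proj (L : zmodClosed (quat R)) (x : quat R) : torus L :=
  \pi_(torus L) x.

(* Each such [U] is the image of a chart of the atlas, namely the inverse of
   the restriction of [torus_proj L] to [U], defined on [torus_proj L @` U]. *)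
Definition chart_image (L : zmodClosed (quat R)) (U : set (quat R)) : Prop :=
  [/\ open U, connected U & {in U &, injective (torus_proj L)}].

Definition chart (L : zmodClosed (quat R)) (U : set (quat R)) :
    torus L -> quat R :=
  'pinv_(fun=> 0) U (torus_proj L).

(* The expression of [f] in the charts given by [U] and [V] is
   [chart V \o f \o torus_proj L], on the part of [U] that [f] sends to the domain
   of the second chart. That part is open because [f] is continuous. *)
Definition regular_map (L L' : zmodClosed (quat R))
    (f : torus L -> torus L') : Prop :=
  continuous f /\
  forall U V, chart_image L U -> chart_image L' V ->
  slice_regular (U `&` (f \o torus_proj L) @^-1` (torus_proj L' @` V))
    (@chart L' V \o f \o torus_proj L).

Definition biregular_diffeomorphism (L L' : zmodClosed (quat R))
    (f : torus L -> torus L') : Prop :=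
  regular_map f /\
  exists g : torus L' -> torus L, [/\ cancel f g, cancel g f & regular_map g].

Definition equivalent_tori (L L' : zmodClosed (quat R)) : Prop :=
  exists f : torus L -> torus L', biregular_diffeomorphism f.

End Tori.

Section Moduli.
Context {R : realType}.

Definition gram (v : 4.-tuple (quat R)) : 'M[R]_4 :=
  \matrix_(i, j) qdot (tnth v i) (tnth v j).

(* With 0-based indices, gcd(n_k, ..., n_4) is the gcd over j >= k. *)
Definition reduced (G : 'M[R]_4) : Prop :=
  (forall k l : 'I_4, l = k.+1 :> nat -> 0 <= G k l) /\
  (forall (k : 'I_4) (n : 'rV[int]_4),
     \big[gcdn/0%N]_(j < 4 | (k <= j)%N) absz (n 0 j) = 1%N ->
     G k k <= (map_mx intr n *m G *m (map_mx intr n)^T) 0 0).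

Definition special_basis (v : 4.-tuple (quat R)) : Prop :=
  [/\ free v, reduced (gram v) & tnth v 0 = qone].

Definition fundamental_set : set (quat R * quat R * quat R) :=
  [set w | special_basis [tuple qone; w.1.1; w.1.2; w.2]].

End Moduli.

(* Main.v *)
From HB Require Import structures.
Require Import Defs.
From mathcomp Require Import all_boot all_order all_algebra.
From mathcomp Require Import all_classical all_reals all_analysis.
From mathcomp Require Import zify ring lra.

(** Every lattice of quaternions has a basis [v_1, ..., v_4] reduced in the
    sense of Minkowski, and right multiplication by the inverse of [v_1] turns
    it into a special basis without leaving the equivalence class of the torus.

    Reduction. Positive definiteness makes the length of the lattice vectors
    attain its minimum on every nonempty set of coordinate vectors
    ([sqnorm_min]). Hence [v_1, v_2, ...] can be chosen one after the other,
    each as short as possible among the vectors that, together with the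
    previous ones, extend to a basis of the lattice ([successive_minima]). A
    combination [sum n_i v_i] with [gcd(n_k, ..., n_4) = 1] is one of the
    candidates for [v_k], because an integer vector that is primitive from its
    [k]-th entry on can replace the [k]-th row of the identity matrix and be
    completed to a unimodular matrix ([complete_row], from the Smith normal
    form of a row). This gives the minimality half of reducedness. Changing
    the signs of the [v_k] one after the other makes consecutive vectors form
    non-obtuse angles and disturbs neither the lengths nor the gcds
    ([exists_minkowski_reduced]).

    Normalisation. Right multiplication by a quaternion [b] multiplies all
    scalar products by [|b|^2], so it preserves reducedness ([qdot_qmul],
    [reduced_gram]); with [b] the inverse of [v_1] the first vector becomes 1.
    It is also slice regular: on the slice of [I] it is
    [x + y I |-> x b + y (I b)], whose derivatives [b] and [I b] satisfy
    [b + I (I b) = 0]. A map induced on tori by right multiplication is, read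
    in the charts, right multiplication by [b] followed locally by a
    translation, because two points in the same class differ by a lattice
    vector and the charts are defined on open sets; translations do not affect
    the derivatives ([locally_affine_slice_regular], [torus_qmulr_regular]).
    Its inverse is of the same kind, with the inverse of [b] in place of [b]
    ([equivalent_tori_qmulr]). *)

Set Implicit Arguments.
Unset Strict Implicit.
Unset Printing Implicit Defensive.

Import Order.TTheory GRing.Theory Num.Theory.
Import numFieldNormedType.Exports.

Local Open Scope classical_set_scope.
Local Open Scope ring_scope.
Local Open Scope quotient_scope.

(** * Unimodular completion of primitive integer vectors *)

Section PrimitiveVectors.

(** The Smith normal form of a row is [e] times the first row of a unimodular
    matrix; [e] divides every entry, so it is a unit and can be absorbed into
    the matrix. The divisibility form of the gcd condition avoids choosing an
    index set for the gcd. *)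
Lemma primitive_row (p : nat) (v : 'rV[int]_p.+1) :
  (forall d : nat, (forall j, (d %| absz (v 0%R j))%N) -> d = 1%N) ->
  exists2 W : 'M[int]_p.+1, W \in unitmx & row 0 W = v.
Proof.
move=> v_prim; have [L uL [W uW [d _ defv]]] := int_Smith_normal_form v.
pose e := L 0 0 * d`_0.
have ve : v = e *: row 0 W.
  rewrite {1}defv [L]mx11_scalar mul_scalar_mx -scalemxAl; apply/rowP => j.
  rewrite !mxE big_ord_recl big1 => [|i _]; rewrite !mxE ?mulr1n ?addr0 ?mulrA //=.
  by rewrite mulr0n mul0r.
have ue : e \is a GRing.unit.
  have -> : (e \is a GRing.unit) = (absz e == 1%N) by case: (e) => -[|[|?]].
  apply/eqP/v_prim => j.
  by rewrite ve !mxE abszM dvdn_mulr.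
exists (e *: W); first by rewrite unitmxE detZ unitrM unitrX // -unitmxE.
by rewrite ve; apply/rowP => j; rewrite !mxE.
Qed.

(** Only the last [p.+1] entries of [u] have to be completed; its first [k]
    entries go below the identity block, where they do not change the
    determinant. *)
Lemma complete_block (k p : nat) (u : 'rV[int]_(k + p.+1)) :
  (forall d : nat,
    (forall j : 'I_(k + p.+1), (k <= j)%N -> (d %| absz (u 0%R j))%N) -> d = 1%N) ->
  exists2 W : 'M[int]_(k + p.+1), W \in unitmx &
    row (rshift k 0) W = u /\
    forall i : 'I_(k + p.+1), (i < k)%N -> row i W = delta_mx 0 i.
Proof.
move=> u_prim.
have [|W uW W0] := @primitive_row p (rsubmx u).
  move=> d d_dvd; apply: u_prim => j; case: (split_ordP j) => j' -> /=.
    by rewrite leqNgt ltn_ord.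
  by move=> _; have := d_dvd j'; rewrite mxE.
pose A : 'M[int]_(p.+1, k) := \matrix_(i, j) (lsubmx u 0 j *+ (i == 0)).
exists (block_mx 1%:M 0 A W).
  by rewrite unitmxE det_lblock det1 mul1r -unitmxE.
split.
  rewrite -[RHS]hsubmxK -W0; apply/rowP => j.
  rewrite [LHS]mxE; case: (split_ordP j) => j' ->.
    by rewrite block_mxEdl row_mxEl !mxE eqxx.
  by rewrite block_mxEdr row_mxEr !mxE.
move=> i; case: (split_ordP i) => i' -> //= _.
apply/rowP => j; rewrite [LHS]mxE; case: (split_ordP j) => j' ->.
  by rewrite block_mxEul !mxE eqxx /= eq_lshift eq_sym.
by rewrite block_mxEur !mxE eqxx /= eq_rlshift.
Qed.

(** The vectors [u] that, with the first [k] vectors of the standard basis,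
    extend to a basis of the integer lattice: this is where the gcd condition
    in the definition of reducedness comes from. *)
Lemma complete_row (n : nat) (k : 'I_n) (u : 'rV[int]_n) :
  \big[gcdn/0%N]_(j < n | (k <= j)%N) absz (u 0%R j) = 1%N ->
  exists2 W : 'M[int]_n, W \in unitmx &
    row k W = u /\ forall i : 'I_n, (i < k)%N -> row i W = delta_mx 0 i.
Proof.
case: k => k lt_kn /= gcd1.
have u_prim (d : nat) :
    (forall j : 'I_n, (k <= j)%N -> (d %| absz (u 0%R j))%N) -> d = 1%N.
  move=> d_dvd; apply/eqP; rewrite -dvdn1 -gcd1.
  by elim/big_rec: _ => [|j x /d_dvd dj dx]; rewrite ?dvdn0 // dvdn_gcd dj.
have [p def_n] : exists p, n = (k + p.+1)%N.
  by exists (n - k).-1; rewrite prednK ?subn_gt0 // subnKC // ltnW.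
subst n; have [W uW [Wk Wi]] := complete_block u_prim.
exists W => //; split=> //.
by rewrite -Wk; congr (row _ W); apply: val_inj; rewrite /= addn0.
Qed.

End PrimitiveVectors.

(** * Minkowski reduction *)

Section Minkowski.
Variables (R : realType) (n : nat).
Implicit Types (x : 'rV[R]_n) (z : 'rV[int]_n) (V : 'M[R]_n) (U : 'M[int]_n).

Definition sqnorm x : R := (x *m x^T) 0 0.

Lemma sqnormE x : sqnorm x = \sum_j x 0 j ^+ 2.
Proof. by rewrite /sqnorm mxE; apply: eq_bigr => j _; rewrite mxE. Qed.

(** A crude comparison that avoids square roots; it follows from
    [t <= 1 + t^2]. *)
Lemma entry_le_sqnorm x j : `|x 0 j| <= 1 + sqnorm x.
Proof.
have le_j : x 0 j ^+ 2 <= sqnorm x.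
  by rewrite sqnormE (bigD1 j) //= lerDl sumr_ge0 // => i _; rewrite sqr_ge0.
apply: le_trans (lerD (lexx 1) le_j); rewrite -real_normK ?num_real //.
set t := `|_|; have := sqr_ge0 (t - 1); nra.
Qed.

(** The coordinates of a lattice vector in the basis [V] are recovered by the
    inverse of [V], so a bound on the length of the vector bounds them. *)
Lemma sublevel_bounded V (B : R) : V \in unitmx ->
  exists N : nat, forall z, sqnorm (map_mx intr z *m V) <= B ->
    forall i, (absz (z 0%R i) <= N)%N.
Proof.
move=> uV; pose C := \sum_i \sum_j `|invmx V j i|.
have C_ge0 : 0 <= C by do 2![apply: sumr_ge0 => ? _].
exists (Num.bound ((1 + B) * C)) => z le_zB i.
set x := map_mx intr z *m V in le_zB.
have zx : map_mx intr z = x *m invmx V by rewrite mulmxK.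
have B1_ge0 : 0 <= 1 + B.
  apply: le_trans (lerD (lexx 1) le_zB).
  by rewrite addr_ge0 // sqnormE sumr_ge0 // => j _; rewrite sqr_ge0.
suff le_zi : `|(z 0 i)%:~R| <= (1 + B) * C :> R.
  rewrite -(ler_nat R) (le_trans _ (ltW (archi_boundP _))) ?mulr_ge0 //.
  by rewrite natr_absz intr_norm.
have -> : (z 0 i)%:~R = (map_mx intr z : 'rV[R]_n) 0 i by rewrite mxE.
rewrite zx mxE (le_trans (ler_norm_sum _ _ _)) //.
have le_C : \sum_j `|invmx V j i| <= C.
  by rewrite /C [leRHS](bigD1 i) //= lerDl; do 2![apply: sumr_ge0 => ? _].
apply: le_trans (ler_wpM2l B1_ge0 le_C); rewrite mulr_sumr.
apply: ler_sum => j _; rewrite normrM ler_wpM2r //.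
by rewrite (le_trans (entry_le_sqnorm _ _)) // lerD2l.
Qed.

(** By [sublevel_bounded] the competitors of any given element of [S] have
    coordinates in a finite box, so the minimum is one over a finite type. *)
Lemma sqnorm_min V (S : 'rV[int]_n -> Prop) : V \in unitmx -> (exists z, S z) ->
  exists2 z, S z &
    forall y : 'rV[int]_n, S y ->
      sqnorm (map_mx intr z *m V) <= sqnorm (map_mx intr y *m V).
Proof.
move=> uV [z0 Sz0]; pose q z := sqnorm (map_mx intr z *m V).
have [N leN] := sublevel_bounded (q z0) uV.
(* The entries of a vector of the box [-N, N] are stored shifted by [N]. *)
pose decode (w : 'rV['I_(N + N).+1]_n) : 'rV[int]_n :=
  map_mx (fun k : 'I_(N + N).+1 => k%:Z - N%:Z) w.
have decodeP z : q z <= q z0 -> exists w, decode w = z.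
  move=> le_z; exists (map_mx (fun a => inord (absz (a + N%:Z))) z).
  apply/rowP => j; rewrite !mxE inordK.
    by have := leN z le_z j; move: (z 0 j) => a; lia.
  by have := leN z le_z j; move: (z 0 j) => a; lia.
have [w0 w0E] := decodeP _ (lexx (q z0)).
pose P w := `[< S (decode w) >].
have Pw0 : P w0 by apply/asboolP; rewrite w0E.
case: (@arg_minP _ _ _ w0 P (q \o decode) Pw0) => w /asboolP Sw wmin.
exists (decode w) => // y Sy; rewrite -/(q _) -/(q _).
have [le_y|lt_y] := leP (q y) (q z0).
  have [w' yE] := decodeP y le_y; rewrite -yE; apply: wmin.
  by apply/asboolP; rewrite yE.
by apply: le_trans (ltW lt_y); rewrite -w0E; apply: wmin.
Qed.

(** The greedy choice: the rows of [U] hold the coordinates of the new basis,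
    and once the first [k] of them are fixed, row [k] minimises the length over
    all unimodular matrices that share these [k] rows. The condition on row
    [i] involves only the rows up to [i], so later choices preserve it. *)
Lemma successive_minima V k : V \in unitmx ->
  exists2 U, U \in unitmx & forall i : 'I_n, (i < k)%N ->
    forall U', U' \in unitmx ->
    (forall j : 'I_n, (j < i)%N -> row j U' = row j U) ->
    sqnorm (map_mx intr (row i U) *m V) <= sqnorm (map_mx intr (row i U') *m V).
Proof.
move=> uV; elim: k => [|k [U uU Umin]]; first by exists 1%:M; rewrite ?unitmx1.
have [lt_kn|le_nk] := ltnP k n; last first.
  by exists U => // i _; apply: Umin; apply: leq_trans (ltn_ord i) le_nk.
pose k' := Ordinal lt_kn.
pose S z := exists2 U', U' \in unitmx &
  (forall j : 'I_n, (j < k)%N -> row j U' = row j U) /\ z = row k' U'.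
have [|z [U1 uU1 [U1U ->]] zmin] := @sqnorm_min V S uV.
  by exists (row k' U), U.
exists U1 => // i; rewrite ltnS leq_eqVlt => /predU1P[ik|lt_ik] U' uU' U'U1.
  have -> : i = k' by apply: val_inj.
  apply: zmin; exists U' => //; split=> // j lt_jk.
  by rewrite U'U1 ?ik // U1U.
rewrite U1U //; apply: Umin => // j lt_ji.
by rewrite U'U1 // U1U //; apply: ltn_trans lt_ji lt_ik.
Qed.

(** The minimality half of reducedness, for the Gram matrix of the rows of
    [W]. *)
Definition shortest_extensions (W : 'M[R]_n) : Prop :=
  forall (i : 'I_n) z,
    \big[gcdn/0%N]_(j < n | (i <= j)%N) absz (z 0%R j) = 1%N ->
    sqnorm (row i W) <= sqnorm (map_mx intr z *m W).

(** The successive minima satisfy the gcd condition, because [complete_row]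
    turns each [z] it allows into row [i] of a unimodular matrix that shares
    the previous rows. *)
Lemma exists_shortest_extensions V : V \in unitmx ->
  exists2 U, U \in unitmx & shortest_extensions (map_mx intr U *m V).
Proof.
move=> uV; have [U uU Umin] := successive_minima n uV.
exists U => // i z /complete_row[W uW [Wi WE]].
rewrite mulmxA -map_mxM row_mul -map_row.
have -> : z *m U = row i (W *m U) by rewrite row_mul Wi.
apply: Umin; rewrite ?unitmx_mul ?uW // => j lt_ji.
by rewrite row_mul WE // -rowE.
Qed.

End Minkowski.

Section Signs.
Variables (R : realType) (n : nat).

Lemma sqnormZ (a : R) (x : 'rV[R]_n) : sqnorm (a *: x) = a ^+ 2 * sqnorm x.
Proof. by rewrite /sqnorm linearZ -scalemxAl -scalemxAr scalerA mxE. Qed.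

(** The sign half of reducedness, for the Gram matrix of the rows of [W]. *)
Definition acute_consecutive (W : 'M[R]_n) : Prop :=
  forall k l : 'I_n, l = k.+1 :> nat -> 0 <= (W *m W^T) k l.

Lemma gram_entry (W : 'M[R]_n) k l :
  (W *m W^T) k l = (row k W *m (row l W)^T) 0 0.
Proof. by rewrite !mxE; apply: eq_bigr => j _; rewrite !mxE. Qed.

(** Each sign is determined by the previous one, since only consecutive indices
    are constrained. *)
Lemma exists_consecutive_signs (G : nat -> nat -> R) :
  exists s : nat -> bool, forall k,
    0 <= (-1) ^+ s k * (-1) ^+ s k.+1 * G k k.+1.
Proof.
pose s := fix s k := if k is k'.+1 then s k' (+) (G k' k < 0) else false.
exists s => k; rewrite /= signr_addb mulrA -expr2 sqrr_sign mul1r.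
by rewrite -normrEsign.
Qed.

(** The signs act by a diagonal matrix [D] with entries 1 and -1. Acting on the
    coordinate vectors instead, [D] leaves the absolute values of their entries
    unchanged, so the gcd condition survives. *)
Lemma exists_minkowski_reduced (V : 'M[R]_n) : V \in unitmx ->
  exists2 U : 'M[int]_n, U \in unitmx &
    shortest_extensions (map_mx intr U *m V) /\
    acute_consecutive (map_mx intr U *m V).
Proof.
move=> /exists_shortest_extensions[U0 uU0]; set W0 := _ *m V => W0_short.
(* Rows indexed by natural numbers, with a dummy value past the last row. *)
pose r i : 'rV[R]_n := oapp (fun j : 'I_n => row j W0) 0 (insub i).
have rE (i : 'I_n) : r i = row i W0 by rewrite /r valK.
have [s s_ge0] := exists_consecutive_signs (fun k l => (r k *m (r l)^T) 0 0).
pose D : 'M[int]_n := diag_mx (\row_i (-1) ^+ s i).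
have uD : D \in unitmx.
  suff /mulmx1_unit[] : D *m D = 1%:M by [].
  rewrite /D mulmx_diag -diag_const_mx; congr diag_mx.
  by apply/rowP => i; rewrite !mxE -expr2 sqrr_sign.
have WE : map_mx intr (D *m U0) *m V = map_mx intr D *m W0.
  by rewrite map_mxM -mulmxA.
have rowE i : row i (map_mx intr D *m W0) = (-1) ^+ s i *: row i W0.
  rewrite row_mul -map_row row_diag_mx mxE map_mxZ /= map_delta_mx.
  by rewrite -scalemxAl -rowE rmorph_sign.
exists (D *m U0); first by rewrite unitmx_mul uD.
rewrite WE; split=> [i z gcd_z|k l lk].
  rewrite rowE sqnormZ sqrr_sign mul1r mulmxA -map_mxM; apply: W0_short.
  rewrite -[RHS]gcd_z; apply: eq_bigr => j _.
  by rewrite mul_mx_diag !mxE abszM abszX /= exp1n muln1.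
rewrite gram_entry !rowE linearZ -scalemxAl -scalemxAr !mxE mulrA.
by have := s_ge0 k; rewrite -lk !rE !mxE.
Qed.

End Signs.

(** * Right multiplication of quaternions *)

Section Quat.
Context {R : realType}.
Implicit Types (a b p q x y : 'rV[R]_4).

Lemma ord4P (P : 'I_4 -> Prop) : P 0 -> P 1 -> P 2 -> P 3 -> forall i, P i.
Proof.
move=> P0 P1 P2 P3 i.
have : i \in [:: 0; 1; 2; 3] by case: i => -[|[|[|[|]]]].
by rewrite !inE => /or4P[] /eqP->.
Qed.

Lemma sum4E (V : nmodType) (F : 'I_4 -> V) :
  \sum_(i < 4) F i = F 0 + (F 1 + (F 2 + F 3)).
Proof.
rewrite !big_ord_recl big_ord0 addr0.
by congr (F _ + (F _ + (F _ + F _))); apply: val_inj.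
Qed.

Lemma mkquatE (a b c d : R) :
  ((mkquat a b c d 0 0 = a) * (mkquat a b c d 0 1 = b) *
  (mkquat a b c d 0 2 = c) * (mkquat a b c d 0 3 = d))%type.
Proof. by rewrite /mkquat !mxE. Qed.

Lemma quatP p q :
  p 0 0 = q 0 0 -> p 0 1 = q 0 1 -> p 0 2 = q 0 2 -> p 0 3 = q 0 3 -> p = q.
Proof. by move=> ? ? ? ?; apply/rowP; apply: ord4P. Qed.

(** Identities of quaternions hold coordinate by coordinate, as polynomial
    identities. *)
Ltac quat := rewrite /qone /qmul; apply: quatP; rewrite !mxE /=; ring.

Lemma qmulA p q x : qmul p (qmul q x) = qmul (qmul p q) x.
Proof. quat. Qed.

Lemma qmul1q p : qmul qone p = p. Proof. quat. Qed.
Lemma qmulq1 p : qmul p qone = p. Proof. quat. Qed.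

Lemma qmul_is_linear b : linear (fun x => qmul x b).
Proof. move=> k p q; quat. Qed.

(** Named so that it can carry a structure of linear map. *)
Definition qmulr b := fun x => qmul x b.

HB.instance Definition _ b :=
  GRing.isLinear.Build R 'rV[R]_4 'rV[R]_4 _ (qmulr b) (qmul_is_linear b).

(** The norm of quaternions is multiplicative, in polarised form: right
    multiplication is a similarity. *)
Lemma qdot_qmul x y b : qdot (qmul x b) (qmul y b) = qdot b b * qdot x y.
Proof. by rewrite /qdot !sum4E /qmul !mkquatE; ring. Qed.

(** The conjugate divided by the squared norm. *)
Definition qinv a : 'rV[R]_4 :=
  (qdot a a)^-1 *: mkquat (a 0 0) (- a 0 1) (- a 0 2) (- a 0 3).

Lemma qdot_gt0 a : a != 0 -> 0 < qdot a a.
Proof.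
move=> a_neq0; rewrite lt0r psumr_eq0 => [|i _]; last by rewrite -expr2 sqr_ge0.
rewrite sumr_ge0 => [|i _]; last by rewrite -expr2 sqr_ge0.
rewrite andbT; apply: contra a_neq0 => /allP a0; apply/eqP/rowP => i.
have := a0 i (mem_index_enum _); rewrite mxE -expr2.
by rewrite sqrf_eq0 => /eqP.
Qed.

Lemma qmulqV a : a != 0 -> qmul a (qinv a) = qone.
Proof.
move=> /qdot_gt0/lt0r_neq0; rewrite /qinv /qdot sum4E => d_neq0.
by rewrite /qone /qmul; apply: quatP; rewrite !mxE /=; field.
Qed.

Lemma qmulVq a : a != 0 -> qmul (qinv a) a = qone.
Proof.
move=> /qdot_gt0/lt0r_neq0; rewrite /qinv /qdot sum4E => d_neq0.
by rewrite /qone /qmul; apply: quatP; rewrite !mxE /=; field.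
Qed.

End Quat.

(** * Slice regularity of locally affine maps *)

Section Slice.
Context {R : realType}.
Implicit Types (b c x I : 'rV[R]_4).

Lemma qmulr_continuous b : continuous (qmulr b).
Proof.
have -> : qmulr b = fun x => \sum_(j < 4) x 0 j *: qmulr b (delta_mx 0 j).
  apply/funext => x; rewrite {1}[x]row_sum_delta linear_sum.
  by apply: eq_bigr => j _; rewrite linearZ.
apply: continuous_big; first exact: add_continuous.
by move=> j _ x; apply: continuousZr_tmp; apply: coord_continuous.
Qed.

Lemma slice_continuous I : continuous (fun z : R * R => slice I z.1 z.2).
Proof.
move=> z; apply: cvgD; apply: cvgZr_tmp; [exact: cvg_fst|exact: cvg_snd].
Qed.

Lemma is_derive_affine (V : normedModType R) (u c : V) (t : R) :
  is_derive t 1 (fun s : R => s *: u + c) u.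
Proof.
have dZ : is_derive t 1 ( *:%R^~ u) u.
  have D := is_diff_scalel t u.
  apply: DeriveDef; first exact: diff_derivable.
  by rewrite deriveE // diff_val scale1r.
by have := is_deriveD dZ (is_derive_cst c t 1); rewrite addr0.
Qed.

Lemma qmul_slice I s t b : qmul (slice I s t) b = s *: b + t *: qmul I b.
Proof. by rewrite -/(qmulr b _) linearD !linearZ /= /qmulr qmul1q. Qed.

(** The constant [c] may change from point to point. On the slice of [I] the
    partial derivatives of [y |-> y b + c] are [b] and [I b], whence the
    Cauchy-Riemann equation from [I^2 = -1]. *)
Lemma locally_affine_slice_regular (Omega : set 'rV[R]_4) f b :
  (forall x, Omega x -> exists c, \forall y \near x, f y = qmul y b + c) ->
  slice_regular Omega f.
Proof.
move=> f_aff I I_imag fI OmegaI dx dy z /f_aff[c fc].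
pose P (w : R * R) := fI w.1 w.2 = qmul (slice I w.1 w.2) b + c.
(* The identity near [slice I z] holds near every [w] close to [z] too, so the
   derivatives are constant around [z]; this gives their continuity. *)
have nP : \forall w \near z, nbhs w P.
  by apply: nbhs_interior; apply: slice_continuous fc.
have Dx : \forall w \near z, is_derive (w.1 : R) 1 (fI^~ w.2) b.
  apply: filterS nP => -[s0 t0] /= Pw.
  apply: (near_eq_is_derive (f := fun s : R => s *: b + (t0 *: qmul I b + c))).
    have C : {for s0, continuous (fun s : R => (s, t0))}.
      by apply: (@cvg_pair _ _ _ (nbhs s0) (nbhs s0) (nbhs t0) _ _ _ id (cst t0));
        [exact: cvg_id|exact: cvg_cst].
    move: (C _ Pw); apply: (@filterS _ _ (nbhs_filter _)) => s /=.
    by rewrite /P /= qmul_slice addrA.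
  exact: is_derive_affine.
have Dy : \forall w \near z, is_derive (w.2 : R) 1 (fI w.1) (qmul I b).
  apply: filterS nP => -[s0 t0] /= Pw.
  apply: (near_eq_is_derive (f := fun t : R => t *: qmul I b + (s0 *: b + c))).
    have C : {for t0, continuous (fun t : R => (s0, t))}.
      by apply: (@cvg_pair _ _ _ (nbhs t0) (nbhs s0) (nbhs t0) _ _ _ (cst s0) id);
        [exact: cvg_cst|exact: cvg_id].
    move: (C _ Pw); apply: (@filterS _ _ (nbhs_filter _)) => t /=.
    by rewrite /P /= qmul_slice addrCA addrA.
  exact: is_derive_affine.
have dxE : \forall w \near z, dx w = b.
  by apply: filterS Dx => w Dw; rewrite /dx derive1E derive_val.
have dyE : \forall w \near z, dy w = qmul I b.
  by apply: filterS Dy => w Dw; rewrite /dy derive1E derive_val.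
have [Dxz Dyz] := (nbhs_singleton Dx, nbhs_singleton Dy).
split.
- by split; apply: ex_derive.
- exact: near_cst_continuous dxE.
- exact: near_cst_continuous dyE.
- rewrite (nbhs_singleton dxE) (nbhs_singleton dyE) qmulA I_imag.
  by rewrite -/(qmulr b _) linearN /= /qmulr qmul1q subrr scaler0.
Qed.

End Slice.

(** * Maps of tori induced by right multiplication *)

Section TorusMaps.
Context {R : realType}.
Implicit Types (L : zmodClosed 'rV[R]_4) (b x y : 'rV[R]_4).

Lemma torus_projP L x y : (torus_proj L x = torus_proj L y) <-> (x - y \in L).
Proof.
by rewrite Quotient.idealrBE; split=> [xy|/eqP]//; apply/eqP.
Qed.

Lemma torus_proj_repr L (t : torus L) : torus_proj L (repr t) = t.
Proof. exact: reprK. Qed.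

(** Independent of the representative [repr t] as soon as right multiplication
    by [b] maps [L] into [L']; see [torus_qmulrE]. *)
Definition torus_qmulr L L' b (t : torus L) : torus L' :=
  torus_proj L' (qmul (repr t) b).

Lemma torus_qmulrE L L' b x : (forall y, y \in L -> qmul y b \in L') ->
  torus_qmulr L' b (torus_proj L x) = torus_proj L' (qmul x b).
Proof.
move=> LL'; apply/torus_projP; rewrite -[_ - _](linearB (qmulr b)); apply: LL'.
by apply/torus_projP; rewrite torus_proj_repr.
Qed.

(** If [v] in [V] represents the image of the class of [x], then near [x] the
    expression of the map in the charts is [y |-> y b + (v - x b)]: this value
    is in the right class, since [v - x b] is in [L'], and stays in the open
    set [V], on which the projection is injective. *)
Lemma torus_qmulr_regular L L' b : (forall y, y \in L -> qmul y b \in L') ->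
  regular_map (@torus_qmulr L L' b).
Proof.
move=> LL'; split.
  apply/quotient_continuous.
  have -> : @torus_qmulr L L' b \o \pi = torus_proj L' \o qmulr b.
    by apply/funext => x; exact: torus_qmulrE.
  move=> x; apply: continuous_comp; first exact: qmulr_continuous.
  exact: pi_continuous.
move=> U V _ [oV _ injV].
apply: (@locally_affine_slice_regular _ _ _ b) => x [_ /= [v Vv]].
rewrite torus_qmulrE // => v_xb.
exists (v - qmul x b).
have : \forall y \near x, V (qmul y b + (v - qmul x b)).
  have : {for x, continuous (fun y => qmulr b y + (v - qmulr b x))}.
    by apply: continuousD; [exact: qmulr_continuous|exact: cst_continuous].
  by apply; apply: open_nbhs_nbhs; split => //; rewrite addrC subrK.
apply: filterS => y Vy /=.
rewrite torus_qmulrE //.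
have -> : torus_proj L' (qmul y b) = torus_proj L' (qmul y b + (v - qmul x b)).
  apply/torus_projP; rewrite opprD addrA subrr add0r -rpredN opprK.
  by apply/torus_projP.
by rewrite /chart pinvKV // inE.
Qed.

(** The inverse of the induced map is induced by right multiplication by the
    inverse quaternion. *)
Lemma equivalent_tori_qmulr L L' b : b != 0 ->
  (forall x, x \in L <-> qmul x b \in L') -> equivalent_tori L L'.
Proof.
move=> b0 LL'; exists (@torus_qmulr L L' b).
have LL'_b y : y \in L -> qmul y b \in L' by move/LL'.
have L'L_b y : y \in L' -> qmul y (qinv b) \in L.
  by move=> yL'; apply/LL'; rewrite -qmulA qmulVq // qmulq1.
split; first exact: torus_qmulr_regular.
exists (@torus_qmulr L' L (qinv b)); split; last exact: torus_qmulr_regular.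
- move=> t; rewrite -[t]torus_proj_repr !torus_qmulrE //.
  by rewrite -qmulA qmulqV // qmulq1.
- move=> t; rewrite -[t]torus_proj_repr !torus_qmulrE //.
  by rewrite -qmulA qmulVq // qmulq1.
Qed.

End TorusMaps.

(** * Lattice bases as matrices *)

Section Bases.
Context {R : realType}.

Definition basis_mx m p (v : m.-tuple 'rV[R]_p) : 'M[R]_(m, p) :=
  \matrix_i tnth v i.

Lemma inIntSpan_mx m p (v : m.-tuple 'rV[R]_p) x :
  inIntSpan v x <-> exists z : 'rV[int]_m, x = map_mx intr z *m basis_mx v.
Proof.
have E (a : int ^ m) (z : 'rV[int]_m) : (forall i, a i = z 0 i) ->
    \sum_(i < m) v`_i *~ a i = map_mx intr z *m basis_mx v.
  move=> az; rewrite mulmx_sum_row; apply: eq_bigr => i _.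
  by rewrite rowK mxE az scaler_int (tnth_nth 0).
split=> [[a ->]|[z ->]].
  by exists (\row_i a i); apply: E => i; rewrite mxE.
by exists [ffun i => z 0 i]; apply/esym/E => i; rewrite ffunE.
Qed.

Lemma free_basis_mx m p (v : m.-tuple 'rV[R]_p) : free v = row_free (basis_mx v).
Proof.
have E (k : 'I_m -> R) (z : 'rV[R]_m) : (forall i, k i = z 0 i) ->
    \sum_(i < m) k i *: v`_i = z *m basis_mx v.
  move=> kz; rewrite mulmx_sum_row; apply: eq_bigr => i _.
  by rewrite rowK kz (tnth_nth 0).
apply/freeP/idP => [v_free|v_free k].
  apply: inj_row_free => z z0; apply/rowP => i; rewrite mxE.
  by apply: (v_free (fun i => z 0 i)); rewrite (E _ z).
rewrite (E k (\row_i k i)) => [/eqP|i]; last by rewrite mxE.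
by rewrite mulmx_free_eq0 // => /eqP/rowP k0 i; have := k0 i; rewrite !mxE.
Qed.

(** The factor [c] accounts for similarities, which scale the Gram matrix. *)
Lemma reduced_gram (c : R) (W : 'M[R]_4) : 0 <= c ->
  shortest_extensions W -> acute_consecutive W -> reduced (c *: (W *m W^T)).
Proof.
move=> c_ge0 W_short W_acute; split=> [k l lk|k z gcd_z].
  by rewrite mxE mulr_ge0 // W_acute.
rewrite -scalemxAr -scalemxAl !mxE ler_wpM2l //.
have := W_short k z gcd_z; rewrite /sqnorm -gram_entry trmx_mul !mulmxA.
by rewrite mxE [X in _ <= X]mxE.
Qed.

End Bases.

(** * Existence of a modulus *)

Theorem proposition7p3 (R : realType) (L : zmodClosed (quat R))
    (hL : rank4_lattice L) :
  exists v2 v3 v4 : quat R,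
    fundamental_set (v2, v3, v4) /\
    equivalent_tori L (zspan [tuple qone; v2; v3; v4]).
Proof.
have [v [v_free L_span]] := hL.
have uV : basis_mx v \in unitmx by rewrite -row_free_unit -free_basis_mx.
have [U uU] := exists_minkowski_reduced uV.
set W := _ *m basis_mx v => -[W_short W_acute].
have uW : W \in unitmx.
  by rewrite unitmx_mul uV andbT unitmxE det_map_mx rmorph_unit // -unitmxE.
pose a := row 0 W.
have a_neq0 : a != 0.
  rewrite /a rowE mulmx_free_eq0 ?row_free_unit //.
  by apply/eqP => /rowP/(_ 0)/eqP; rewrite !mxE oner_eq0.
pose b := qinv a.
have ab : qmul a b = qone by exact: qmulqV.
have b_neq0 : b != 0.
  apply/eqP => b0; have := qmulVq a_neq0; rewrite -/b b0 -/(qmulr a 0) linear0.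
  by move=> /rowP/(_ 0)/eqP; rewrite !mxE eq_sym oner_eq0.
pose v' k := qmul (row k W) b.
exists (v' 1), (v' 2), (v' 3); set w := [tuple _; _; _; _].
have wE : forall i, tnth w i = v' i by apply: ord4P; rewrite /v' -?ab.
pose M := lin1_mx (qmulr b).
have wM : basis_mx w = W *m M.
  by apply/row_matrixP => i; rewrite rowK wE row_mul mul_rV_lin1.
split.
  have uM : M \in unitmx.
    suff /mulmx1_unit[] : M *m lin1_mx (qmulr a) = 1%:M by [].
    apply/row_matrixP => i; rewrite row_mul row1 rowE !mul_rV_lin1 /= /qmulr.
    by rewrite -qmulA qmulVq // qmulq1.
  split=> //.
    by rewrite free_basis_mx wM row_free_unit unitmx_mul uW.
  have -> : gram w = qdot b b *: (W *m W^T).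
    apply/matrixP => i j; rewrite [LHS]mxE !wE qdot_qmul [RHS]mxE gram_entry.
    congr (_ * _); rewrite [RHS]mxE.
    by apply: eq_bigr => k _; rewrite [X in _ = _ * X]mxE.
  by apply: reduced_gram => //; apply/ltW/qdot_gt0.
apply: (equivalent_tori_qmulr b_neq0) => x.
have bM z : map_mx intr z *m basis_mx w = qmul (map_mx intr z *m W) b.
  by rewrite wM mulmxA mul_rV_lin1.
rewrite L_span inIntSpan_mx; split.
  move=> [z ->]; apply/asboolP/inIntSpan_mx; exists (z *m invmx U).
  by rewrite bM mulmxA -map_mxM mulmxKV.
move=> /asboolP/inIntSpan_mx[z]; rewrite bM => xz; exists (z *m U).
rewrite map_mxM -mulmxA -/W -[RHS]qmulq1 -(qmulVq a_neq0) qmulA -xz.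
by rewrite -qmulA qmulVq // qmulq1.
Qed.
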